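(* Let $\mathcal M$ be a (nonempty) uncertain MDP and $k>0$ an integer. The algorithm KAPS, run on $(\mathcal M,k)$ without a time limit, terminates and returns an optimal solution to the $k$-adaptable policy synthesis problem; that is, the returned policies $\pi_1,\dots,\pi_k$ minimize $$\max_{M\in\mathcal M}\ \min_{i\in\{1,\dots,k\}}\bigl(V^\star(M)-V(M,\pi_i)\bigr)$$ over all choices of $k$ deterministic memoryless policies.
   Context: **MDPs.** A discounted MDP is $M=(S,A,T,R,\gamma,\mu)$ with finite state set $S$, finite action set $A$, transition distributions $T(\cdot\mid s,a)\in\Delta(S)$, reward $R:S\times A\times S\to\mathbb R$, discount $\gamma\in(0,1)$, initial distribution $\mu\in\Delta(S)$. All policies are deterministic and memoryless, $\pi:S\to A$, with value $V(M,\pi)=\mathbb E[\sum_{t\ge0}\gamma^tR(s_t,\pi(s_t),s_{t+1})]$, $s_0\sim\mu$, $s_{t+1}\sim T(\cdot\mid s_t,\pi(s_t))$, and $V^\star(M)=\max_\pi V(M,\pi)$. A UMDP is a finite set of MDPs sharing $S,A,\gamma$ (the $T_i,R_i,\mu_i$ may differ). Write $\mathrm{reg}(M,\pi)=V^\star(M)-V(M,\pi)$, and for $\mathcal M'\subseteq\mathcal M$, $\mathrm{reg}(\mathcal M',\pi)=\max_{M\in\mathcal M'}\mathrm{reg}(M,\pi)$ and $\mathrm{reg}^\star(\mathcal M')=\min_\pi\mathrm{reg}(\mathcal M',\pi)$ (a maximum over the empty set is $0$; a minimum over the empty set is $+\infty$). **PolicySearch**$(\mathcal M',c)$, for $\mathcal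 M'\subseteq\mathcal M$ and cutoff $c$. A policy-search node $N$ is a set of rules $\mathrm{force}(s,a)$, $\mathrm{forbid}(s,a)$; it represents the set $\Pi_N$ of policies $\pi$ with $\pi(s)=a$ for each rule $\mathrm{force}(s,a)\in N$ and $\pi(s)\ne a$ for each rule $\mathrm{forbid}(s,a)\in N$. Define $\mathrm{BoundPolicy}(N)=\max_{M\in\mathcal M'}(V^\star(M)-V^\star_N(M))$ with $V_N^\star(M)=\max_{\pi\in\Pi_N}V(M,\pi)$. $\mathrm{GuessPolicy}(N)$ is a policy in $\Pi_N$ that is optimal, subject to the restrictions of $N$, for the MDP obtained by averaging $T_i,R_i,\mu_i$ over $M_i\in\mathcal M'$. $\mathrm{BranchPolicy}(N)$ returns $(s,a)$ where, among the states at which the policies of $\Pi_N$ do not all agree, $s$ has the highest occupancy under the policy $\mathrm{GuessPolicy}(N)$ (ties arbitrary), and $a$ is the action of that policy at $s$. The procedure: start with queue $Q=\{N_0\}$, where $N_0$ has no rules, and $\pi_{\rm best}=\bot$, $U=c$, $L=0$. While $Q\neq\emptyset$ and $L<U$: remove a node $N$ from $Q$ (with equal probability either one with the smallest upper bound or one with the smallest lower bound). If $\Pi_N=\{\pi\}$ is a single policy and $\mathrm{reg}(\mathcal M',\pi)<U$, set $\pi_{\rm best}=\pi$, $U=\mathrm{reg}(\mathcal M',\pi)$. Otherwise, if $|\Pi_N|>1$ and $\mathrm{BoundPolicy}(N)<U$: let $\pi=\mathrm{GuessPolicy}(N)$ and, if $\mathrm{reg}(\mathcal M',\pi)<U$,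 set $\pi_{\rm best}=\pi$, $U=\mathrm{reg}(\mathcal M',\pi)$; then let $(s,a)=\mathrm{BranchPolicy}(N)$ and add $N\cup\{\mathrm{force}(s,a)\}$ and $N\cup\{\mathrm{forbid}(s,a)\}$ to $Q$. At the end of each iteration set $L=\min_{N'\in Q}\mathrm{BoundPolicy}(N')$. Return $(\pi_{\rm best},U)$. **KAPS**$(\mathcal M,k)$. A partition-search node is $N=(\mathcal P_N,\mathcal M_{\rm rem})$, where $\mathcal P_N=(\mathcal M_1,\dots,\mathcal M_k)$ are pairwise disjoint (possibly empty) subsets of $\mathcal M$ and $\mathcal M_{\rm rem}=\mathcal M\setminus\bigcup_i\mathcal M_i$ is the set of unassigned MDPs. $\mathrm{BoundPartition}(N)$ is the maximum of $\mathrm{reg}^\star(\mathcal M'')$ over all $i$ and all subsets $\mathcal M''\subseteq\mathcal M_i$ present in a cache (a collection of subsets of $\mathcal M$ that may grow during the run). $\mathrm{BranchPartition}(N)$ returns the first MDP of $\mathcal M_{\rm rem}$ in an order of $\mathcal M$ fixed before the search (MDPs sorted decreasingly by the largest regret, over all pairs containing the MDP, of the root guess policy for that pair). $\mathrm{GuessPartition}(\mathcal M,k)$ starts with an arbitrary distribution of $\mathcal M$ into $k$ subsets, repeatedly moves a single MDP between subsets whenever this improves (strictly decreases) the estimate $\max_i\mathrm{reg}(\mathcal M_i,\text{root guess policy for }\mathcal M_i)$ (ties broken in favor of more even sizes), until no improving move remains, and returns the resulting partition together with one policy $\pi_i$ per subset (from GuessPolicy or PolicySearch) and the regret $\max_i\mathrm{reg}(\mathcal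 M_i,\pi_i)$. The algorithm: start with $Q=\{((\emptyset,\dots,\emptyset),\mathcal M)\}$, $L=0$, and $(\mathcal P_{\rm best},\Pi_{\rm best},\mathrm{reg}_{\rm best})=\mathrm{GuessPartition}(\mathcal M,k)$. While $Q\ne\emptyset$ and $L<\mathrm{reg}_{\rm best}$: remove from $Q$ a node $N$ with lowest bound. If $\mathcal M_{\rm rem}=\emptyset$: for each $i$ compute $(\pi_i,r_i)=\mathrm{PolicySearch}(\mathcal M_i,\mathrm{reg}_{\rm best})$; if $\max_ir_i<\mathrm{reg}_{\rm best}$, set $(\mathcal P_{\rm best},\Pi_{\rm best},\mathrm{reg}_{\rm best})=(\mathcal P_N,\{\pi_i\}_{i=1}^k,\max_ir_i)$. Otherwise, if $\mathrm{BoundPartition}(N)<\mathrm{reg}_{\rm best}$: let $M=\mathrm{BranchPartition}(N)$ and add to $Q$, for each $i=1,\dots,k$, the node obtained from $N$ by moving $M$ from $\mathcal M_{\rm rem}$ to $\mathcal M_i$. At the end of each iteration set $L=\min_{N'\in Q}\mathrm{BoundPartition}(N')$. Finally return $(\mathcal P_{\rm best},\Pi_{\rm best},\mathrm{reg}_{\rm best})$. *)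

(* Defs.v *)
From HB Require Import structures.
From Stdlib Require Export Relation_Operators.
From mathcomp Require Export all_boot all_order all_algebra.
From mathcomp Require Export all_classical all_reals all_analysis.
From mathcomp Require Import measurable_realfun.
(* [set0], [setT], ... below are those of finite sets, not of classical ones. *)
From mathcomp Require Export finset.

Set Implicit Arguments.
Unset Strict Implicit.
Unset Printing Implicit Defensive.

Import Order.TTheory GRing.Theory Num.Theory.
Export numFieldNormedType.Exports.

Local Open Scope ring_scope.

(* Maximum of [f] over [P], with the convention that the maximum over the empty
   set is [x0]. Minima are written [\big[mine/+oo]] directly. *)
Definition maxover (d : Order.disp_t) (T : orderType d) (x0 : T) (J : finType)
    (P : pred J) (f : J -> T) : T :=
  if [pick j | P j] is Some j0 then f [arg max_(j > j0 | P j) f j]%O else x0.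

Lemma le_maxover (d : Order.disp_t) (T : orderType d) (x0 : T) (J : finType)
    (P : pred J) (f : J -> T) (j : J) :
  P j -> (f j <= maxover x0 P f)%O.
Proof.
rewrite /maxover; case: pickP => [j0 Pj0 Pj|/(_ j)->//].
by case: arg_maxP => // i _; apply.
Qed.

Lemma maxover_attained (d : Order.disp_t) (T : orderType d) (x0 : T)
    (J : finType) (P : pred J) (f : J -> T) (j : J) :
  P j -> exists2 i, P i & maxover x0 P f = f i.
Proof.
rewrite /maxover; case: pickP => [j0 Pj0 _|/(_ j)->//].
by case: arg_maxP => // i Pi _; exists i.
Qed.

(* The raw data of an MDP, without the discount; [is_mdp] says that it is one.
   Raw data are needed because an average over the empty family (which is 0
   everywhere, as 0^-1 = 0) is not an MDP. *)
Record mdp (R : realType) (S A : finType) := Mdp {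
  trans : S -> A -> S -> R;
  reward : S -> A -> S -> R;
  init : S -> R
}.

Definition is_distr (R : realType) (S : finType) (p : S -> R) : Prop :=
  (forall s, 0 <= p s) /\ \sum_s p s = 1.

Definition is_mdp (R : realType) (S A : finType) (m : mdp R S A) : Prop :=
  is_distr (init m) /\ forall s a, is_distr (trans m s a).

Definition policy (S A : finType) := {ffun S -> A}.

(* [inl (s, a)] is force(s,a) and [inr (s, a)] is forbid(s,a). *)
Definition rule (S A : finType) := (S * A + S * A)%type.
Definition node (S A : finType) := {set rule S A}.

Section MDP.
Context {R : realType} {S A : finType}.
Variable gamma : R.

Local Notation policy := (policy S A).
Local Notation node := (node S A).

(* Probability, under [pi], that (s_0, ..., s_n) = w. *)
Definition traj_prob (m : mdp R S A) (pi : policy) (n : nat)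
    (w : {ffun 'I_n.+1 -> S}) : R :=
  init m (w ord0) *
  \prod_(t < n) trans m (w (inord t)) (pi (w (inord t))) (w (inord t.+1)).

Definition traj_expect (m : mdp R S A) (pi : policy) (n : nat)
    (f : {ffun 'I_n.+1 -> S} -> R) : R :=
  \sum_(w : {ffun 'I_n.+1 -> S}) traj_prob m pi w * f w.

(* The expected discounted return E[sum_t gamma^t R(s_t, pi(s_t), s_{t+1})],
   computed as the limit of the expected n-step returns;
   [value_expectation] shows that it is the expectation of the infinite sum on
   any probability space carrying the trajectory process. *)
Definition value (m : mdp R S A) (pi : policy) : R :=
  limn (fun n => traj_expect m pi (fun w : {ffun 'I_n.+1 -> S} =>
    \sum_(t < n) gamma ^+ t *
      reward m (w (inord t)) (pi (w (inord t))) (w (inord t.+1)))).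

Lemma value_expectation (d : measure_display) (Omega : measurableType d)
    (P : probability Omega R) (m : mdp R S A) (pi : policy)
    (X : nat -> Omega -> S) :
  0 < gamma < 1 ->
  (forall n s, measurable (X n @^-1` [set s])%classic) ->
  (forall n (w : {ffun 'I_n.+1 -> S}),
    P [set o | forall t : 'I_n.+1, X t o = w t]%classic =
    (traj_prob m pi w)%:E) ->
  'E_P[(fun o => limn (fun n => \sum_(t < n) gamma ^+ t *
    reward m (X t o) (pi (X t o)) (X t.+1 o)))%R]%E = (value m pi)%:E.
Proof.
move=> /andP[g0 g1] mX lawX.
pose r o t : R := reward m (X t o) (pi (X t o)) (X t.+1 o).
pose g n (w : {ffun 'I_n.+1 -> S}) : R := \sum_(t < n) gamma ^+ t *
  reward m (w (inord t)) (pi (w (inord t))) (w (inord t.+1)).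
pose f n o : R := \sum_(t < n) gamma ^+ t * r o t.
pose E n (w : {ffun 'I_n.+1 -> S}) : set Omega :=
  [set o | forall t : 'I_n.+1, X t o = w t]%classic.
have mE n w : measurable (E n w).
  have -> : E n w = (\bigcap_(t in [set: 'I_n.+1]) (X t @^-1` [set w t]))%classic.
    by apply/seteqP; split=> o /= h t => [_|]; [exact: h|exact: (h t I)].
  by apply: fin_bigcap_measurable.
have fE n o : f n o = \sum_(w : {ffun 'I_n.+1 -> S}) g n w * \1_(E n w) o.
  rewrite (bigD1 [ffun t : 'I_n.+1 => X t o]) //= big1 ?addr0 => [|w].
    rewrite indicE mem_set ?mulr1 => [|t]; last by rewrite ffunE.
    by apply: eq_bigr => t _; rewrite !ffunE !inordK ?ltnS // ltnW.
  move=> /eqP nw; rewrite indicE memNset ?mulr0 // => Ew; apply: nw.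
  by apply/ffunP=> t; rewrite ffunE Ew.
pose B : R := \sum_(s : S) \sum_(a : A) \sum_(s' : S) `|reward m s a s'|.
have B0 : 0 <= B by do 3!apply: sumr_ge0 => ? _.
have rB o t : `|r o t| <= B.
  rewrite /B (bigD1 (X t o)) //= (bigD1 (pi (X t o))) //= (bigD1 (X t.+1 o)) //=.
  rewrite -!addrA lerDl !addr_ge0 //; do ?[apply: sumr_ge0 => ? _] => //.
have fser o : f ^~ o = series (fun t => gamma ^+ t * r o t).
  by apply/funext => n; rewrite /f seriesEord.
have gcv : cvgn (series (geometric B gamma)).
  by apply: is_cvg_geometric_series; rewrite gtr0_norm.
have fcv o : cvgn (f ^~ o).
  rewrite fser; apply: normed_cvg.
  apply: (@series_le_cvg _ _ (geometric B gamma)) => //= n.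
  - by rewrite mulr_ge0 // exprn_ge0 // ltW.
  - rewrite normrM normrX gtr0_norm // mulrC ler_wpM2r // exprn_ge0 // ltW //.
have fB n o : `|f n o| <= B / (1 - gamma).
  apply: (le_trans (ler_norm_sum _ _ _)).
  apply: (@le_trans _ _ (series (geometric B gamma) n)).
    rewrite seriesEord; apply: ler_sum => t _ /=.
    by rewrite normrM normrX gtr0_norm // mulrC ler_wpM2r // exprn_ge0 // ltW.
  rewrite geometric_seriesE ?lt_eqF // ler_wpM2r ?invr_ge0 ?subr_ge0 ?(ltW g1) //.
  by rewrite ler_piMr // lerBlDr lerDl exprn_ge0 // ltW.
have mf n : measurable_fun [set: Omega] (f n).
  have -> : f n = (fun o => \sum_(w : {ffun 'I_n.+1 -> S}) g n w * \1_(E n w) o).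
    by apply/funext => o; exact: fE.
  apply: measurable_sum => w; apply: measurable_funM => //.
have mlim : measurable_fun [set: Omega] (fun o => limn (f ^~ o)).
  by apply: (@measurable_fun_cvg _ _ _ _ (fun n => f n)) => // o _; exact: fcv.
have intf n : (\int[P]_o (f n o)%:E = (traj_expect m pi (g n))%:E)%E.
  under eq_integral => o _ do rewrite fE -sumEFin.
  rewrite integral_sum //; last first.
    move=> w; under eq_fun do rewrite EFinM.
    by apply: integrableZl => //; exact: integrable_indic.
  rewrite /traj_expect -sumEFin; apply: eq_bigr => w _.
  under eq_integral => o _ do rewrite EFinM.
  rewrite integralZl //; last exact: integrable_indic.
  by rewrite integral_indic // classical_sets.setIT [X in (_ * X)%E](lawX n w) -EFinM mulrC.
have [||||| intlim _ cvf] := @dominated_convergence _ _ _ P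
    [set: Omega]%classic measurableT (fun n o => (f n o)%:E)
    (fun o => (limn (f ^~ o))%:E) (cst (B / (1 - gamma))%:E).
- by move=> n; apply/measurable_EFinP.
- exact/measurable_EFinP.
- by apply/aeW => o _; apply: cvg_EFin; [exact: nearW|exact: fcv].
- exact: finite_measure_integrable_cst.
- by apply/aeW => o n _; rewrite lee_fin.
rewrite unlock -[LHS]fineK; last exact: integrable_fin_num intlim.
congr (_%:E); apply/esym; rewrite /value.
apply: cvg_lim => //.
have -> : (fun n => traj_expect m pi (g n)) =
    fine \o (fun n => \int[P]_o (f n o)%:E)%E.
  by apply/funext => n /=; rewrite intf.
apply: fine_cvg; rewrite fineK //; exact: integrable_fin_num intlim.
Qed.

(* Discounted state occupancy: sum over t of gamma^t P(s_t = s). *)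
Definition occupancy (m : mdp R S A) (pi : policy) (s : S) : R :=
  limn (fun n => traj_expect m pi (fun w : {ffun 'I_n.+1 -> S} =>
    \sum_(t < n) gamma ^+ t * (w (inord t) == s)%:R)).

Definition opt_value (m : mdp R S A) : R := maxover 0 predT (value m).

Definition policies (N : node) : {set policy} :=
  [set pi : policy |
    [forall x : S * A, (inl x \in N) ==> (pi x.1 == x.2)] &&
    [forall x : S * A, (inr x \in N) ==> (pi x.1 != x.2)]].

Definition opt_value_in (N : node) (m : mdp R S A) : R :=
  maxover 0 (mem (policies N)) (value m).

(* The states at which the policies of [N] do not all agree. *)
Definition undecided (N : node) : {set S} :=
  [set s | [exists p in policies N, exists q in policies N, p s != q s]].

Section UMDP.
(* A UMDP is a finite family of MDPs; its subsets are the [{set I}]. *)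
Context {I : finType}.
Variable M : I -> mdp R S A.

Definition reg (i : I) (pi : policy) : R := opt_value (M i) - value (M i) pi.

Definition reg_on (X : {set I}) (pi : policy) : R :=
  maxover 0 (mem X) (fun i => reg i pi).

Definition opt_reg (X : {set I}) : \bar R :=
  \big[mine/+oo%E]_(pi : policy) (reg_on X pi)%:E.

Definition average (X : {set I}) : mdp R S A := Mdp
  (fun s a s' => (\sum_(i in X) trans (M i) s a s') / #|X|%:R)
  (fun s a s' => (\sum_(i in X) reward (M i) s a s') / #|X|%:R)
  (fun s => (\sum_(i in X) init (M i) s) / #|X|%:R).

Definition is_guess_policy (guess : {set I} -> node -> policy) : Prop :=
  forall (X : {set I}) (N : node), policies N != set0 ->
    guess X N \in policies N /\
    forall pi, pi \in policies N ->
      value (average X) pi <= value (average X) (guess X N).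

Definition bound_policy (X : {set I}) (N : node) : R :=
  maxover 0 (mem X) (fun i => opt_value (M i) - opt_value_in N (M i)).

(* [guess X N] is GuessPolicy(N) in the search for the subset [X]: any fixed
   selection among the constrained optima. *)
Variable guess : {set I} -> node -> policy.

Definition is_branch_policy (X : {set I}) (N : node) (s : S) (a : A) : Prop :=
  [/\ s \in undecided N,
      forall s', s' \in undecided N ->
        occupancy (average X) (guess X N) s' <=
        occupancy (average X) (guess X N) s
    & a = guess X N s].

Record ps_state := PS {
  ps_queue : seq node;
  ps_best : option policy;
  ps_U : \bar R;
  ps_L : \bar R
}.

Definition ps_init (c : \bar R) : ps_state := PS [:: set0] None c 0%E.

Definition ps_running (st : ps_state) : bool :=
  (ps_queue st != [::]) && (ps_L st < ps_U st)%E.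

(* Lower bound of a node: BoundPolicy; upper bound: the regret of its guess. *)
Definition ps_select (X : {set I}) (Q : seq node) (N : node) : Prop :=
  N \in Q /\
  ((forall N', N' \in Q -> reg_on X (guess X N) <= reg_on X (guess X N')) \/
   (forall N', N' \in Q -> bound_policy X N <= bound_policy X N')).

(* [ps_process X N b U Q' b' U']: treating [N] with incumbent [(b, U)] adds
   the nodes [Q'] to the queue and makes [(b', U')] the incumbent. *)
Inductive ps_process (X : {set I}) (N : node) (b : option policy)
    (U : \bar R) : seq node -> option policy -> \bar R -> Prop :=
| PS_single pi of
    policies N = [set pi] & ((reg_on X pi)%:E < U)%E :
    ps_process X N b U [::] (Some pi) (reg_on X pi)%:E
| PS_single_worse pi of
    policies N = [set pi] & (U <= (reg_on X pi)%:E)%E :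
    ps_process X N b U [::] b U
| PS_branch s a of
    (1 < #|policies N|)%N & ((bound_policy X N)%:E < U)%E &
    is_branch_policy X N s a :
    let pi := guess X N in
    let better := ((reg_on X pi)%:E < U)%E in
    ps_process X N b U
      [:: inl (s, a) |: N; inr (s, a) |: N]
      (if better then Some pi else b)
      (if better then (reg_on X pi)%:E else U)
| PS_prune of
    #|policies N| != 1%N &
    ~~ ((1 < #|policies N|)%N && ((bound_policy X N)%:E < U)%E) :
    ps_process X N b U [::] b U.

(* One iteration of the loop of PolicySearch; the procedure returns
   [(ps_best st, ps_U st)] at the first [st] with [~~ ps_running st]. *)
Inductive ps_step (X : {set I}) : ps_state -> ps_state -> Prop :=
| PS_step Q b U L N Q' b' U' of
    ps_running (PS Q b U L) & ps_select X Q N & ps_process X N b U Q' b' U' :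
    ps_step X (PS Q b U L)
      (PS (rem N Q ++ Q') b' U'
        (\big[mine/+oo%E]_(N' <- rem N Q ++ Q') (bound_policy X N')%:E)).

(* Largest regret, over the pairs containing [i], of the root guess policy. *)
Definition pair_score (i : I) : R :=
  maxover 0 (fun j => j != i)
    (fun j => reg_on [set i; j] (guess [set i; j] set0)).

Definition is_branch_order (ord : seq I) : Prop :=
  perm_eq ord (enum I) /\
  sorted (fun i j => pair_score j <= pair_score i) ord.

Variables (ord : seq I) (k : nat).

(* Partition-search nodes; the unassigned MDPs are those of [unassigned N]. *)
Definition parts := {ffun 'I_k -> {set I}}.

Definition unassigned (N : parts) : {set I} := ~: \bigcup_(i < k) N i.

Definition is_partition (P : parts) : Prop :=
  unassigned P = set0 /\ forall i j, i != j -> [disjoint P i & P j].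

Definition assign (N : parts) (m : I) (i : 'I_k) : parts :=
  [ffun j => if j == i then m |: N j else N j].

Definition branch_partition (N : parts) : option I :=
  ohead [seq m <- ord | m \in unassigned N].

(* [C] is the cache. *)
Definition bound_partition (C : {set {set I}}) (N : parts) : \bar R :=
  maxover 0%E (fun X : {set I} => (X \in C) && [exists i, X \subset N i])
    opt_reg.

Definition estimate (P : parts) : R :=
  maxover 0 predT (fun i => reg_on (P i) (guess (P i) set0)).

Definition is_move (P P' : parts) : Prop :=
  exists (m : I) (a b : 'I_k), [/\ a != b, m \in P a &
    P' = [ffun j => if j == a then P j :\ m
                    else if j == b then m |: P j else P j]].

Definition improving (P P' : parts) : Prop :=
  is_move P P' /\ estimate P' < estimate P.

(* As the sum of the sizes is fixed, smaller means more even sizes. *)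
Definition unevenness (P : parts) : nat := \sum_(i < k) #|P i| ^ 2.

Definition gp_step (P P' : parts) : Prop :=
  improving P P' /\
  forall P'', improving P P'' -> estimate P'' = estimate P' ->
    (unevenness P' <= unevenness P'')%N.

(* [None] is the undefined policy of PolicySearch. *)
Record solution := Solution {
  sol_parts : parts;
  sol_policies : {ffun 'I_k -> option policy};
  sol_reg : \bar R
}.

(* Control points of a run; in [Choose] and [Leaf] the last argument lists what
   was obtained so far, in order, for the first subsets of the partition, and
   in [ChooseSearch] and [LeafSearch] a PolicySearch for the next subset is
   under way. *)
Inductive phase :=
| Improve of parts
| Choose of parts & seq policy
| ChooseSearch of parts & seq policy & ps_state
| Loop of seq parts & \bar R & solution
| Node of seq parts & solution & parts
| Leaf of seq parts & solution & parts & seq (option policy * \bar R)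
| LeafSearch of seq parts & solution & parts & seq (option policy * \bar R)
    & ps_state
| EndIteration of seq parts & solution
| Return of solution.

Inductive phase_step (C : {set {set I}}) : phase -> phase -> Prop :=
(* GuessPartition: local search, then one policy per subset, taken either from
   GuessPolicy or from PolicySearch with some cutoff (falling back on
   GuessPolicy if that search finds no policy below its cutoff) *)
| K_improve P P' of gp_step P P' :
    phase_step C (Improve P) (Improve P')
| K_improved P of (forall P', ~ improving P P') :
    phase_step C (Improve P) (Choose P [::])
| K_choose_guess (P : parts) ps (i : 'I_k) of i = size ps :> nat :
    phase_step C (Choose P ps) (Choose P (rcons ps (guess (P i) set0)))
| K_choose_search P ps c of (size ps < k)%N :
    phase_step C (Choose P ps) (ChooseSearch P ps (ps_init c))
| K_choose_search_step (P : parts) ps (i : 'I_k) st st' of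
    i = size ps :> nat & ps_step (P i) st st' :
    phase_step C (ChooseSearch P ps st) (ChooseSearch P ps st')
| K_choose_search_end (P : parts) ps (i : 'I_k) st of
    i = size ps :> nat & ~~ ps_running st :
    phase_step C (ChooseSearch P ps st)
      (Choose P (rcons ps (odflt (guess (P i) set0) (ps_best st))))
| K_chosen (P : parts) (pi : {ffun 'I_k -> policy}) :
    phase_step C (Choose P (codom pi))
      (Loop [:: [ffun=> set0]] 0%E
        (Solution P [ffun i => Some (pi i)]
          (maxover 0 predT (fun i => reg_on (P i) (pi i)))%:E))
(* main loop *)
| K_select (Q : seq parts) L best (N : parts) of
    (L < sol_reg best)%E & N \in Q &
    (forall N', N' \in Q -> (bound_partition C N <= bound_partition C N')%E) :
    phase_step C (Loop Q L best) (Node (rem N Q) best N)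
| K_return (Q : seq parts) L best of
    (Q == [::]) || (sol_reg best <= L)%E :
    phase_step C (Loop Q L best) (Return best)
| K_leaf Q best N of unassigned N = set0 :
    phase_step C (Node Q best N) (Leaf Q best N [::])
| K_leaf_search Q best N rs of (size rs < k)%N :
    phase_step C (Leaf Q best N rs)
      (LeafSearch Q best N rs (ps_init (sol_reg best)))
| K_leaf_search_step Q best (N : parts) rs (i : 'I_k) st st' of
    i = size rs :> nat & ps_step (N i) st st' :
    phase_step C (LeafSearch Q best N rs st) (LeafSearch Q best N rs st')
| K_leaf_search_end Q best N rs st of ~~ ps_running st :
    phase_step C (LeafSearch Q best N rs st)
      (Leaf Q best N (rcons rs (ps_best st, ps_U st)))
| K_leaf_end Q best N (res : {ffun 'I_k -> option policy * \bar R}) :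
    let r := maxover 0%E predT (fun i => (res i).2) in
    phase_step C (Leaf Q best N (codom res))
      (EndIteration Q
        (if (r < sol_reg best)%E then Solution N [ffun i => (res i).1] r
         else best))
| K_branch Q best N m of
    unassigned N != set0 & (bound_partition C N < sol_reg best)%E &
    branch_partition N = Some m :
    phase_step C (Node Q best N)
      (EndIteration (Q ++ [seq assign N m i | i <- enum 'I_k]) best)
| K_prune Q best N of
    unassigned N != set0 & (sol_reg best <= bound_partition C N)%E :
    phase_step C (Node Q best N) (EndIteration Q best)
| K_end_iteration Q best :
    phase_step C (EndIteration Q best)
      (Loop Q (\big[mine/+oo%E]_(N <- Q) bound_partition C N) best).

(* A configuration carries the cache, which any step may enlarge. *)
Definition config := (phase * {set {set I}})%type.

Definition kaps_step (c c' : config) : Prop :=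
  c.2 \subset c'.2 /\ phase_step c.2 c.1 c'.1.

Definition kaps_initial (c : config) : Prop :=
  exists2 P : parts, is_partition P & c.1 = Improve P.

(* Objective of the k-adaptable policy synthesis problem. *)
Definition adapt_reg (pi : {ffun 'I_k -> policy}) : \bar R :=
  maxover 0%E predT
    (fun i : I => \big[mine/+oo%E]_(j < k) (reg i (pi j))%:E).

End UMDP.
End MDP.

Arguments parts : clear implicits.
Arguments config : clear implicits.
Arguments kaps_step {R S A} gamma {I} M guess ord {k} c c'.

(* Main.v *)
Require Import Defs.
From mathcomp Require Import zify.

(* Termination: a natural-number measure of the phase decreases at each step,
   whatever the cache. A queued node weighs exponentially in what it leaves open
   (the number of its policies, resp. of its unassigned MDPs), and a
   PolicySearch in progress is charged to the leaf it serves.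

   Optimality: call a partial partition consistent with competing policies sigma
   if each MDP assigned to subset j has, under sigma_j, regret at most the
   objective value of sigma. Every bound of a consistent node, whatever the
   cache, is then at most that value, and each unassigned MDP can be assigned
   so as to keep consistency. So, for every sigma, either the incumbent is
   already as good as sigma or some queued node is consistent with sigma; when
   the loop stops, the first alternative holds. PolicySearch has the analogous
   invariant, with membership of a policy in a node in place of consistency. *)

Set Implicit Arguments.
Unset Strict Implicit.
Unset Printing Implicit Defensive.

Import Order.TTheory GRing.Theory Num.Theory.

Local Open Scope ring_scope.

(** * Extrema over lists and finite types *)

Lemma seq_argmin (d : Order.disp_t) (T : orderType d) (J : eqType)
    (f : J -> T) (s : seq J) :
  s != [::] -> exists2 x, x \in s & forall y, y \in s -> (f x <= f y)%O.
Proof.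
elim: s => // a s IH _.
have [->|s0] := eqVneq s [::].
  by exists a; rewrite ?mem_head // => y; rewrite inE => /eqP->.
have [x xs xmin] := IH s0.
have [ax|xa] := leP (f a) (f x).
  exists a; rewrite ?mem_head // => y; rewrite inE => /predU1P[->//|/xmin].
  exact: le_trans.
exists x; rewrite ?inE ?xs ?orbT // => y; rewrite inE => /predU1P[->|/xmin//].
exact: ltW.
Qed.

Lemma maxover_le (d : Order.disp_t) (T : orderType d) (x0 y : T) (J : finType)
    (P : pred J) (f : J -> T) :
  (x0 <= y)%O -> (forall j, P j -> (f j <= y)%O) -> (maxover x0 P f <= y)%O.
Proof.
by rewrite /maxover; case: pickP => // j0 Pj0 _; case: arg_maxP => // i Pi _; apply.
Qed.

(** * PolicySearch on a single subset of MDPs *)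

Section Search.
Context {R : realType} {S A I : finType}.
Variables (gamma : R) (M : I -> mdp R S A).
Variable guess : {set I} -> node S A -> policy S A.

Local Notation policy := (policy S A).
Local Notation node := (node S A).
Local Notation reg := (reg gamma M).
Local Notation reg_on := (reg_on gamma M).
Local Notation bound_policy := (bound_policy gamma M).
Local Notation ps_step := (ps_step gamma M guess).
Local Notation ps_process := (ps_process gamma M guess).

Lemma reg_ge0 i pi : 0 <= reg i pi.
Proof. by rewrite subr_ge0 le_maxover. Qed.

Lemma reg_on_ge0 X pi : 0 <= reg_on X pi.
Proof.
case: (set_0Vmem X) => [->|[i iX]].
  by rewrite /Defs.reg_on /maxover; case: pickP => // i; rewrite /= inE.
exact: le_trans (reg_ge0 i pi) (le_maxover _ _ iX).
Qed.

(** In each MDP the constrained optimum is at least the value of [pi]. So discarding a node whose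
    bound reaches the incumbent loses no better policy. *)
Lemma bound_policy_le X (N : node) pi :
  pi \in policies N -> bound_policy X N <= reg_on X pi.
Proof.
move=> piN; apply: maxover_le => [|i iX]; first exact: reg_on_ge0.
apply: le_trans (le_maxover _ (reg ^~ pi) iX).
by rewrite lerD2l lerN2 le_maxover.
Qed.

Lemma policies_force N s a :
  policies (inl (s, a) |: N) = policies N :&: [set pi : policy | pi s == a].
Proof.
apply/setP=> pi; rewrite !inE; apply/andP/andP=> [[/forallP h /forallP h']|].
  split; last by have := h (s, a); rewrite !inE eqxx.
  apply/andP; split; apply/forallP=> x; apply/implyP=> xN.
    by apply: (implyP (h x)); rewrite inE xN orbT.
  by apply: (implyP (h' x)); rewrite inE xN orbT.
move=> [/andP[/forallP h /forallP h'] /eqP sa].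
split; apply/forallP=> x; rewrite !inE; apply/implyP.
  by case/orP=> [/eqP[->]/=|/(implyP (h x))//]; apply/eqP.
by move/(implyP (h' x)).
Qed.

Lemma policies_forbid N s a :
  policies (inr (s, a) |: N) = policies N :&: [set pi : policy | pi s != a].
Proof.
apply/setP=> pi; rewrite !inE; apply/andP/andP=> [[/forallP h /forallP h']|].
  split; last by have := h' (s, a); rewrite !inE eqxx.
  apply/andP; split; apply/forallP=> x; apply/implyP=> xN.
    by apply: (implyP (h x)); rewrite inE xN orbT.
  by apply: (implyP (h' x)); rewrite inE xN orbT.
move=> [/andP[/forallP h /forallP h'] sa].
split; apply/forallP=> x; rewrite !inE; apply/implyP.
  by move/(implyP (h x)).
by case/orP=> [/eqP[->]//|/(implyP (h' x))].
Qed.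

Lemma mem_policies0 (pi : policy) : pi \in policies set0.
Proof.
by rewrite inE; apply/andP; split; apply/forallP=> x; rewrite inE.
Qed.

(* The base 3 makes a branching, which yields two strictly smaller sets,
   decrease the measure. *)
Definition ps_measure (st : @ps_state R S A) : nat :=
  \sum_(N <- ps_queue st) 3 ^ #|policies N|.

Lemma ps_measure_init c :
  ps_measure (ps_init c) = (3 ^ #|policies (set0 : node)|)%N.
Proof. by rewrite /ps_measure big_seq1. Qed.

(** * Termination of PolicySearch *)

Section Termination.
Hypothesis guess_in : forall X N, policies N != set0 -> guess X N \in policies N.

(** Both children of a branching are strictly smaller: as the state is undecided, some policy of [N]
    deviates there from the guessed action, while the guess itself follows it. *)
Lemma ps_step_measure X st st' :
  ps_step X st st' -> (ps_measure st' < ps_measure st)%N.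
Proof.
case=> Q b U L N Q' b' U' _ [NQ _] proc.
rewrite /ps_measure /= big_cat (big_rem N NQ) /= addnC ltn_add2r.
case: proc => [||s a /card_gt1P[p0 [_ [p0N _ _]]] _ [+ _ ->]|];
  rewrite ?big_nil ?expn_gt0 //.
rewrite inE => /existsP[p /andP[pN /existsP[q /andP[qN pq]]]].
have gN : guess X N \in policies N by apply: guess_in; apply/set0Pn; exists p.
rewrite big_cons big_seq1 policies_force policies_forbid.
set a0 := guess X N s.
have lt1 : (#|policies N :&: [set pi : policy | pi s == a0]| < #|policies N|)%N.
  apply/proper_card/properP; split; first exact: subsetIl.
  have [pa|pa] := eqVneq (p s) a0; last by exists p; rewrite // !inE (negPf pa) andbF.
  by exists q; rewrite // !inE -pa [q s == _]eq_sym (negPf pq) andbF.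
have lt2 : (#|policies N :&: [set pi : policy | pi s != a0]| < #|policies N|)%N.
  apply/proper_card/properP; split; first exact: subsetIl.
  by exists (guess X N); rewrite // !inE eqxx andbF.
case: #|policies N| lt1 lt2 => // n; rewrite !ltnS => le1 le2.
have := leq_pexp2l (isT : 0 < 3)%N le1; have := leq_pexp2l (isT : 0 < 3)%N le2.
have : (0 < 3 ^ n)%N by rewrite expn_gt0.
rewrite expnS; move: (3 ^ n)%N (3 ^ #|_ :&: _|)%N (3 ^ #|_|)%N => x y z.
by move=> ? ? ? _ _; lia.
Qed.

End Termination.

(** A node of smallest bound is a legal choice, and the rules of [ps_process] cover every node.
    Branching finds an undecided state of highest occupancy because two distinct policies differ at
    some state. *)
Lemma ps_progress X st : ps_running st -> exists st', ps_step X st st'.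
Proof.
case: st => Q b U L run; have /andP[/= Q0 _] := run.
have [N NQ Nmin] := seq_argmin (bound_policy X) Q0.
suff [Q' [b' [U' proc]]] : exists Q' b' U', ps_process X N b U Q' b' U'.
  eexists; apply: (PS_step run _ proc).
  by split=> //; right.
have [/cards1P[pi Npi]|N1] := boolP (#|policies N| == 1%N).
  have [lt|le] := ltP (reg_on X pi)%:E U; do 3!eexists.
    exact: PS_single _ _ Npi lt.
  exact: PS_single_worse _ _ Npi le.
have [/andP[gt1 lt]|npr] :=
    boolP ((1 < #|policies N|)%N && ((bound_policy X N)%:E < U)%E); last first.
  by do 3!eexists; exact: PS_prune _ _ _ _ N1 npr.
have U0 : enum (undecided N) != [::].
  have /card_gt1P[p [q [pN qN pq]]] := gt1.
  have [s pqs] : exists s, p s != q s.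
    by apply/existsP; apply: contraNT pq => /existsPn h; apply/eqP/ffunP=> s;
      apply/eqP/negPn.
  suff : s \in enum (undecided N) by case: (enum _).
  rewrite mem_enum inE; apply/existsP; exists p; rewrite pN.
  by apply/existsP; exists q; rewrite qN.
have [s sU smax] :=
  seq_argmin (fun s => - occupancy gamma (average M X) (guess X N) s) U0.
do 3!eexists; apply: (@PS_branch _ _ _ _ _ _ _ _ _ _ _ s (guess X N s)) => //.
rewrite mem_enum in sU.
by split=> // s' s'U; rewrite -lerN2 smax // mem_enum.
Qed.

(** * Correctness of PolicySearch *)

(** The second clause bounds the regret of every policy from below, so a search that returns no
    policy certifies that none beats the cutoff [c]. *)
Definition ps_result X (c : \bar R) (r : option policy * \bar R) : Prop :=
  (r = (None, c) \/ exists pi, r = (Some pi, (reg_on X pi)%:E)) /\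
  forall pi, (r.2 <= (reg_on X pi)%:E)%E.

(** The inequality on [ps_L] accompanies each policy still queued, so that stopping because [ps_L]
    reaches [ps_U] settles it too. *)
Definition ps_inv X (c : \bar R) (st : @ps_state R S A) : Prop :=
  ((ps_best st = None /\ ps_U st = c) \/
    exists pi, ps_best st = Some pi /\ ps_U st = (reg_on X pi)%:E) /\
  forall pi, (ps_U st <= (reg_on X pi)%:E)%E \/
    ((ps_L st <= (reg_on X pi)%:E)%E /\
     exists2 N, N \in ps_queue st & pi \in policies N).

Lemma ps_inv_init X c : ps_inv X c (ps_init c).
Proof.
split; first by left.
move=> pi; right; split; first by rewrite lee_fin reg_on_ge0.
by exists set0; rewrite ?mem_head ?mem_policies0.
Qed.

Lemma ps_inv_step X c st st' : ps_inv X c st -> ps_step X st st' -> ps_inv X c st'.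
Proof.
move=> inv step; case: step inv => Q b U L N Q' b' U' _ [NQ _] proc [/= incb cov].
(* Processing [N] keeps the incumbent genuine and never worsens it, and leaves each policy of [N]
   either matched or in a child. *)
have [inc' U'U cov'] : [/\ (b' = None /\ U' = c) \/
       exists pi, b' = Some pi /\ U' = (reg_on X pi)%:E,
     (U' <= U)%E &
     forall pi, pi \in policies N -> (U' <= (reg_on X pi)%:E)%E \/
       exists2 N', N' \in Q' & pi \in policies N'].
  case: proc => [pi Npi lt|pi Npi le|s a _ _ br pi better|N1].
  - split; [by right; exists pi|exact: ltW|].
    by move=> p; rewrite Npi inE => /eqP->; left.
  - by split=> // p; rewrite Npi inE => /eqP->; left.
  - split.
    + by rewrite /better; case: ifP => // _; right; exists pi.
    + by rewrite /better; case: ifP => // /ltW.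
    + move=> p pN; right; have [psa|psa] := eqVneq (p s) a.
        exists (inl (s, a) |: N); first by rewrite mem_head.
        by rewrite policies_force inE pN inE psa eqxx.
      exists (inr (s, a) |: N); first by rewrite !inE eqxx orbT.
      by rewrite policies_forbid inE pN inE.
  (* A pruned node that contains a policy contains at least two, so its bound is what pruned it. *)
  - move=> npr; split=> // p pN; left.
    have n0 : (0 < #|policies N|)%N by apply/card_gt0P; exists p.
    have gt1 : (1 < #|policies N|)%N by rewrite ltn_neqAle eq_sym N1.
    move: npr; rewrite gt1 /= -leNgt => /le_trans; apply.
    by rewrite lee_fin bound_policy_le.
split=> //= pi.
suff [|[N' N'Q piN']] : (U' <= (reg_on X pi)%:E)%E \/
    exists2 N', N' \in rem N Q ++ Q' & pi \in policies N'; first by left.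
  right; split; last by exists N'.
  apply: (@bigmin_inf_seq _ _ _ _ _ N') => //.
  by rewrite lee_fin bound_policy_le.
have [le|[_ [N' N'Q piN']]] := cov pi.
  by left; exact: le_trans U'U le.
have [eN|nN] := eqVneq N' N.
  rewrite {}eN in piN'; have [|[N'' N''Q' piN'']] := cov' _ piN'; first by left.
  by right; exists N''; rewrite // mem_cat N''Q' orbT.
right; exists N' => //; rewrite mem_cat; apply/orP; left.
by move: N'Q; rewrite (perm_mem (perm_to_rem NQ)) inE (negPf nN).
Qed.

Lemma ps_inv_end X c st :
  ps_inv X c st -> ~~ ps_running st -> ps_result X c (ps_best st, ps_U st).
Proof.
case: st => Q b U L [/= inc cov]; rewrite negb_and negbK -leNgt /= => stop.
split.
  by case: inc => [[-> ->]|[pi [-> ->]]]; [left|right; exists pi].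
move=> pi; have [//|[Lle [N NQ _]]] := cov pi.
by case/orP: stop => [/eqP Q0|/le_trans->//]; rewrite Q0 in NQ.
Qed.

End Search.

(** * Partition search: unassigned MDPs and branching *)

Section Kaps.
Context {R : realType} {S A I : finType}.
Variables (gamma : R) (M : I -> mdp R S A).
Variable guess : {set I} -> node S A -> policy S A.
Variables (ord : seq I) (k : nat).

Local Notation policy := (policy S A).
Local Notation parts := (parts I k).
Local Notation phase := (@phase R S A I k).
Local Notation reg := (reg gamma M).
Local Notation reg_on := (reg_on gamma M).
Local Notation opt_reg := (opt_reg gamma M).
Local Notation adapt_reg := (adapt_reg gamma M).
Local Notation estimate := (estimate gamma M guess).
Local Notation improving := (improving gamma M guess).
Local Notation bound_partition := (bound_partition gamma M).
Local Notation phase_step := (phase_step gamma M guess ord).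

Lemma unassigned_root : unassigned ([ffun=> set0] : parts) = setT.
Proof.
apply/setP=> i; rewrite !inE; apply/negP=> /bigcupP[j _].
by rewrite ffunE inE.
Qed.

Lemma mem_unassigned (N : parts) i :
  (i \in unassigned N) = [forall j, i \notin N j].
Proof.
rewrite inE; apply/negP/forallP=> [h j|h /bigcupP[j _]].
  by apply/negP=> iN; apply: h; apply/bigcupP; exists j.
exact/negP/h.
Qed.

Lemma unassigned_assign (N : parts) m j :
  unassigned (assign N m j) = unassigned N :\ m.
Proof.
apply/setP=> i; rewrite in_setD1 !mem_unassigned.
apply/forallP/andP=> [h|[im /forallP h] l].
  have := h j; rewrite ffunE eqxx !inE negb_or => /andP[im _]; split=> //.
  apply/forallP=> l; have := h l; rewrite ffunE; case: eqP => // ->.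
  by rewrite !inE negb_or => /andP[].
by rewrite ffunE; case: eqP => // _; rewrite !inE negb_or im h.
Qed.

Lemma branch_partition_unassigned (N : parts) m :
  branch_partition ord N = Some m -> m \in unassigned N.
Proof.
rewrite /branch_partition; case E: [seq _ <- _ | _] => [//|a s] /= [<-].
by have := mem_head a s; rewrite -E mem_filter => /andP[].
Qed.

(** * Termination measure of KAPS *)

(** The measure of a fresh PolicySearch, plus one unit each for entering and leaving it. *)
Definition search_cost : nat := (3 ^ #|policies (set0 : node S A)|).+2.

(** The 4 pays for the steps outside the searches, from opening a leaf to selecting the next
    node. *)
Definition leaf_cost : nat := k * search_cost + 4.

(** With base [k.+1], the [k] children of a node, each with one unassigned MDP fewer, weigh strictly
    less than it. *)
Definition queue_measure (Q : seq parts) : nat :=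
  \sum_(N <- Q) k.+1 ^ #|unassigned N|.

(** Local search is charged the number of partitions of smaller estimate, which drops at each move;
    [choosing] prepays the partition search from the root. *)
Definition phase_measure (p : phase) : nat :=
  let choosing := (leaf_cost * k.+1 ^ #|I| + 2)%N in
  match p with
  | Improve P => #|[set P' : parts | (estimate P' < estimate P)%R]|
                 + k * search_cost + choosing + 1
  | Choose P ps => (k - size ps) * search_cost + choosing
  | ChooseSearch P ps st =>
      (k - (size ps).+1) * search_cost + ps_measure st + 1 + choosing
  | Loop Q _ _ => leaf_cost * queue_measure Q + 1
  | Node Q _ N => leaf_cost * (queue_measure Q + k.+1 ^ #|unassigned N|)
  | Leaf Q _ _ rs =>
      leaf_cost * queue_measure Q + (k - size rs) * search_cost + 3
  | LeafSearch Q _ _ rs st =>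
      leaf_cost * queue_measure Q + (k - (size rs).+1) * search_cost
      + ps_measure st + 4
  | EndIteration Q _ => leaf_cost * queue_measure Q + 2
  | Return _ => 0
  end.

Lemma subn_search_cost n :
  (n < k)%N -> ((k - n) * search_cost = (k - n.+1) * search_cost + search_cost)%N.
Proof. by move=> nk; rewrite -mulSnr subnSK. Qed.

Lemma phase_step_measure C p p' :
  (forall X N, policies N != set0 -> guess X N \in policies N) ->
  phase_step C p p' -> (phase_measure p' < phase_measure p)%N.
Proof.
move=> guess_in.
case=> [P P' [[_ imp] _]|P _|P ps i si|P ps c lt|P ps i st st' _ step
  |P ps i st _ _|P pi|Q L best N _ NQ _|Q L best _|Q best N N0
  |Q best N rs lt|Q best N rs i st st' _ step|Q best N rs st _
  |Q best N res|Q best N m _ _ br|Q best N _ _|Q best] /=.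
- rewrite !ltn_add2r; apply/proper_card/properP; split.
    apply/fintype.subsetP=> P''; rewrite in_set => lt.
    by rewrite in_set; exact: lt_trans lt imp.
  by exists P'; rewrite in_set ?ltxx //; exact: imp.
- by rewrite subn0; lia.
- by rewrite size_rcons (subn_search_cost (n := size ps)) -?si // /search_cost; lia.
- by rewrite (subn_search_cost lt) ps_measure_init /search_cost; lia.
- by have := ps_step_measure guess_in step; lia.
- by rewrite size_rcons; lia.
- rewrite size_codom card_ord subnn mul0n add0n /queue_measure big_seq1.
  by rewrite unassigned_root cardsT ltn_add2l.
- rewrite [queue_measure Q](big_rem N NQ) /= addnC.
  by rewrite [X in (leaf_cost * X)%N]addnC addn1.
- lia.
- by rewrite N0 cards0 expn0 mulnDr muln1 subn0 /leaf_cost; lia.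
- by rewrite (subn_search_cost lt) ps_measure_init /search_cost; lia.
- by have := ps_step_measure guess_in step; lia.
- by rewrite size_rcons; lia.
- by rewrite size_codom card_ord subnn mul0n; lia.
- have mN := branch_partition_unassigned br.
  have -> : queue_measure (Q ++ [seq assign N m i | i <- enum 'I_k]) =
      (queue_measure Q + k * k.+1 ^ #|unassigned N :\ m|)%N.
    rewrite /queue_measure big_cat big_map big_enum /=; congr (_ + _)%N.
    rewrite -[X in (X * _)%N](card_ord k) -sum_nat_const.
    by apply: eq_bigr => j _; rewrite unassigned_assign.
  rewrite (cardsD1 m (unassigned N)) mN expnS.
  have : (0 < k.+1 ^ #|unassigned N :\ m|)%N by rewrite expn_gt0.
  rewrite /leaf_cost; move: (k.+1 ^ _)%N (queue_measure _) => x q; nia.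
- have : (0 < k.+1 ^ #|unassigned N|)%N by rewrite expn_gt0.
  by rewrite /leaf_cost; move: (k.+1 ^ _)%N (queue_measure _) => x q; nia.
- by rewrite addn1 addn2.
Qed.

(** * The objective and consistent partial partitions *)

(** As [k] is positive, the inner minimum is attained at some [j] instead of being the default
    [+oo]; branching will assign the MDP to that subset. *)
Lemma adapt_reg_le_reg (sigma : {ffun 'I_k -> policy}) (i : I) :
  (0 < k)%N -> exists j, ((reg i (sigma j))%:E <= adapt_reg sigma)%E.
Proof.
move=> k0; have [j _ ej] := @eq_bigmin _ _ _ +oo%E (Ordinal k0) predT
  (fun j => (reg i (sigma j))%:E) isT (fun j _ => leey _).
exists j; rewrite -ej.
exact: (le_maxover _ (fun i => \big[mine/+oo%E]_j (reg i (sigma j))%:E)).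
Qed.

Lemma adapt_reg_ge0 (sigma : {ffun 'I_k -> policy}) :
  (0 < k)%N -> (0 < #|I|)%N -> (0 <= adapt_reg sigma)%E.
Proof.
move=> k0 /card_gt0P[i _]; have [j] := adapt_reg_le_reg sigma i k0.
by apply: le_trans; rewrite lee_fin reg_ge0.
Qed.

Definition consistent (N : parts) (sigma : {ffun 'I_k -> policy}) : Prop :=
  forall j i, i \in N j -> ((reg i (sigma j))%:E <= adapt_reg sigma)%E.

Definition covered (Q : seq parts) (r : \bar R) : Prop :=
  forall sigma, (r <= adapt_reg sigma)%E \/
    exists2 N, N \in Q & consistent N sigma.

Definition valid_solution (b : @solution R S A I k) : Prop :=
  exists (P : parts) (pi : {ffun 'I_k -> policy}) (r : \bar R),
    [/\ b = Solution P [ffun i => Some (pi i)] r, unassigned P = set0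
      & forall i, ((reg_on (P i) (pi i))%:E <= r)%E].

Section Invariant.
Hypotheses (k0 : (0 < k)%N) (I0 : (0 < #|I|)%N).

Lemma reg_on_le_adapt_reg (N : parts) sigma j (X : {set I}) :
  consistent N sigma -> X \subset N j ->
  ((reg_on X (sigma j))%:E <= adapt_reg sigma)%E.
Proof.
move=> cN XN; case: (set_0Vmem X) => [->|[i iX]].
  rewrite /Defs.reg_on /maxover; case: pickP => [i|_]; first by rewrite /= inE.
  exact: adapt_reg_ge0.
have [l lX] := maxover_attained 0 (reg ^~ (sigma j)) (iX : mem X i).
rewrite /Defs.reg_on => ->.
exact: cN (fintype.subsetP XN l lX).
Qed.

(** For a cached subset of [N j], the policy [sigma j] is a candidate in the minimum [opt_reg],
    whatever the cache [C]. *)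
Lemma bound_partition_le C (N : parts) sigma :
  consistent N sigma -> (bound_partition C N <= adapt_reg sigma)%E.
Proof.
move=> cN; apply: maxover_le => [|X /andP[_ /existsP[j XN]]].
  exact: adapt_reg_ge0.
apply: (bigmin_inf (sigma j)) => //.
exact: reg_on_le_adapt_reg XN.
Qed.

Lemma covered_le Q r r' : covered Q r -> (r' <= r)%E -> covered Q r'.
Proof.
by move=> cov rr' sigma; case: (cov sigma) => [/(le_trans rr')|]; [left|right].
Qed.

Lemma covered_perm Q Q' r : covered Q r -> Q =i Q' -> covered Q' r.
Proof.
move=> cov QQ' sigma; case: (cov sigma) => [|[N]]; first by left.
by rewrite QQ'; right; exists N.
Qed.

Lemma covered_replace N Q Q' r : covered (N :: Q) r ->
  (forall sigma, consistent N sigma -> (r <= adapt_reg sigma)%E \/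
     exists2 N', N' \in Q' & consistent N' sigma) ->
  covered (Q ++ Q') r.
Proof.
move=> cov rep sigma; case: (cov sigma) => [|[N']]; first by left.
rewrite inE => /predU1P[->|N'Q] cN'.
  case: (rep _ cN') => [|[N'' N''Q cN'']]; first by left.
  by right; exists N''; rewrite // mem_cat N''Q orbT.
by right; exists N'; rewrite // mem_cat N'Q.
Qed.

(** * The invariant of a run *)

Definition leaf_results (N : parts) (c : \bar R)
    (rs : seq (option policy * \bar R)) : Prop :=
  forall j : 'I_k, (j < size rs)%N ->
    ps_result gamma M (N j) c (nth (None, c) rs j).

(** The GuessPartition phases record a complete assignment and length bounds; the first incumbent
    takes its regret from the policies actually chosen. A node under treatment counts as queued
    until it is settled or replaced by its children. *)
Definition phase_inv (p : phase) : Prop :=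
  match p with
  | Improve P => unassigned P = set0
  | Choose P ps => unassigned P = set0 /\ (size ps <= k)%N
  | ChooseSearch P ps st => unassigned P = set0 /\ (size ps < k)%N
  | Loop Q L b => [/\ valid_solution b, covered Q (sol_reg b)
      & forall N sigma, N \in Q -> consistent N sigma ->
          (L <= adapt_reg sigma)%E]
  | Node Q b N => valid_solution b /\ covered (N :: Q) (sol_reg b)
  | Leaf Q b N rs =>
      [/\ valid_solution b, covered (N :: Q) (sol_reg b), unassigned N = set0,
          (size rs <= k)%N & leaf_results N (sol_reg b) rs]
  | LeafSearch Q b N rs st =>
      [/\ valid_solution b, covered (N :: Q) (sol_reg b), unassigned N = set0,
          (size rs < k)%N & leaf_results N (sol_reg b) rs] /\
      forall j : 'I_k, j = size rs :> nat ->
        ps_inv gamma M (N j) (sol_reg b) st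
  | EndIteration Q b => valid_solution b /\ covered Q (sol_reg b)
  | Return b => valid_solution b /\ covered [::] (sol_reg b)
  end.

Lemma unassigned_move (P P' : parts) :
  is_move P P' -> unassigned P = set0 -> unassigned P' = set0.
Proof.
move=> [m [a [b [ab mP ->]]]] P0; apply/setP=> i.
rewrite in_set0 mem_unassigned; apply/forallP=> h.
have [eim|im] := eqVneq i m.
  by have := h b; rewrite ffunE eq_sym (negPf ab) eqxx !inE eim eqxx.
have : i \in unassigned P.
  rewrite mem_unassigned; apply/forallP=> j; have := h j; rewrite ffunE.
  by case: eqP => [->|_]; [|case: eqP => // ->]; rewrite !inE (negPf im).
by rewrite P0 inE.
Qed.

Lemma leaf_results_codom N c (res : {ffun 'I_k -> option policy * \bar R}) :
  leaf_results N c (codom res) -> forall j, ps_result gamma M (N j) c (res j).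
Proof.
move=> h j; have := h j; rewrite size_codom card_ord => /(_ (ltn_ord j)).
by rewrite /codom /image_mem (nth_map j) ?size_enum_ord // nth_ord_enum.
Qed.

Lemma leaf_end_inv Q b N (res : {ffun 'I_k -> option policy * \bar R}) :
  let r := maxover 0%E predT (fun i => (res i).2) in
  phase_inv (Leaf Q b N (codom res)) ->
  phase_inv (EndIteration Q
    (if (r < sol_reg b)%E then Solution N [ffun i => (res i).1] r else b)).
Proof.
move=> r [val cov N0 _ /leaf_results_codom resP].
have rle sigma : consistent N sigma -> (r <= adapt_reg sigma)%E.
  move=> cN; apply: maxover_le => [|j _]; first exact: adapt_reg_ge0.
  apply: (le_trans ((resP j).2 (sigma j))).
  exact: reg_on_le_adapt_reg cN (subxx _).
have ler j : ((res j).2 <= r)%E.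
  exact: (le_maxover _ (fun i => (res i).2)).
case: ifPn => [lt|]; last first.
  rewrite -leNgt => le; split=> //; rewrite -[Q]cats0.
  by apply: covered_replace cov _ => sigma /rle; left; exact: le_trans le _.
(* A search without a policy returns its cutoff [sol_reg b], which contradicts [r < sol_reg b]. *)
have /fin_all_exists[pi piP] j :
    exists pi, res j = (Some pi, (reg_on (N j) pi)%:E).
  case: (resP j) => [[e|//] _]; have := le_lt_trans (ler j) lt.
  by rewrite e ltxx.
split=> /=.
  exists N, [ffun j => pi j], r; split=> //.
    by congr Solution; apply/ffunP=> j; rewrite !ffunE piP.
  by move=> j; rewrite ffunE; have := ler j; rewrite piP.
rewrite -[Q]cats0; apply: (covered_replace (N := N)).
  exact: covered_le cov (ltW lt).
by move=> sigma /rle; left.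
Qed.

Lemma phase_inv_step C p p' : phase_step C p p' -> phase_inv p -> phase_inv p'.
Proof.
case=> [P P' [[mv _] _]|P _|P ps i si|P ps c lt|P ps i st st' _ step
  |P ps i st si _|P pi|Q L best N lt NQ _|Q L best stop|Q best N N0
  |Q best N rs lt|Q best N rs i st st' si step|Q best N rs st stop
  |Q best N res|Q best N m _ _ br|Q best N _ le|Q best];
  try exact: leaf_end_inv.
- exact: unassigned_move.
- by [].
- by case=> P0 _; split; rewrite // size_rcons -si.
- by case.
- by case.
- by case=> P0 lt; split; rewrite // size_rcons.
(* The root is vacuously consistent with every [sigma], and [L] starts at 0, below every objective
   value. *)
- case=> P0 _; split=> /=.
  + exists P, pi, (maxover 0 predT (fun i => reg_on (P i) (pi i)))%:E.
    by split=> // i; rewrite lee_fin (le_maxover _ (fun i => reg_on (P i) (pi i))).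
  + move=> sigma; right; exists [ffun=> set0]; first exact: mem_head.
    by move=> j i; rewrite ffunE inE.
  + by move=> N sigma _ _; exact: adapt_reg_ge0.
- case=> val cov _; split=> //; apply: covered_perm cov _.
  exact/perm_mem/perm_to_rem.
- case=> val cov Lle; split=> // sigma; left.
  case: (cov sigma) => // [[N NQ cN]].
  case/orP: stop => [/eqP Q0|/le_trans]; first by rewrite Q0 in NQ.
  by apply; exact: Lle cN.
- by case=> val cov; split.
- case=> val cov N0 _ res; split=> // j _; exact: ps_inv_init.
- case=> H inv; split=> // j sj.
  have ji : j = i by apply/val_inj; rewrite /= sj.
  by rewrite -ji in step; exact: ps_inv_step (inv j sj) step.
- case=> [[val cov N0 lt res] inv]; split; rewrite ?size_rcons // => j.
  rewrite size_rcons ltnS nth_rcons leq_eqVlt => /orP[/eqP sj|lts].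
    by rewrite sj ltnn eqxx; apply: ps_inv_end (inv j sj) stop.
  by rewrite lts; exact: res.
(* Putting [m] into a subset whose policy serves it within the objective value of [sigma] gives a
   child still consistent with [sigma]. *)
- case=> val cov; split=> //; apply: covered_replace cov _ => sigma cN; right.
  have [j jle] := adapt_reg_le_reg sigma m k0.
  exists (assign N m j); first by apply: map_f; rewrite mem_enum.
  move=> l i; rewrite ffunE; case: eqP => [->|_]; last exact: cN.
  by rewrite !inE => /predU1P[->|/cN].
- case=> val cov; split=> //; rewrite -[Q]cats0.
  apply: covered_replace cov _ => sigma cN; left.
  exact: le_trans le (bound_partition_le _ cN).
- case=> val cov; split=> // N sigma NQ cN.
  apply: (@bigmin_inf_seq _ _ _ _ _ N) => //; exact: bound_partition_le.
Qed.

(** * Progress: only a return can end a run *)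

(** Brings the lists built during a run into the form that [K_chosen] and [K_leaf_end] demand. *)
Lemma codom_tuple (T : eqType) (s : seq T) :
  size s = k -> exists f : {ffun 'I_k -> T}, s = codom f.
Proof.
case: s => [sk|x s sk]; first by move: k0; rewrite -sk.
exists [ffun i : 'I_k => nth x (x :: s) i].
rewrite -[LHS](mkseq_nth x) sk /mkseq -val_enum_ord -map_comp.
by apply: eq_map => i; rewrite ffunE.
Qed.

Lemma phase_progress C p :
  perm_eq ord (enum I) -> phase_inv p ->
  (exists b, p = Return b) \/ exists p', phase_step C p p'.
Proof.
move=> ord_enum; case: p => [P|P ps|P ps st|Q L b|Q b N|Q b N rs|Q b N rs st|Q b|b];
  last by left; exists b.
- move=> _; right; have [[P1 imp1]|none] := pselect (exists P', improving P P').
    (* Among the improving moves with the estimate of [P1], a least uneven one obeys the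
       tie-breaking of [gp_step]. *)
    pose D P' := `[< improving P P' /\ estimate P' = estimate P1 >].
    have D1 : D P1 by apply/asboolP.
    have [P2 /asboolP[imp2 e2] min2] := arg_minnP (@unevenness I k) D1.
    exists (Improve P2); apply: K_improve; split=> // P' imp' e'.
    by apply/min2/asboolP; split; [exact: imp'|rewrite e' e2].
  by exists (Choose P [::]); apply: K_improved => P' imp; apply: none; exists P'.
- case=> _; rewrite leq_eqVlt => /orP[/eqP|] sk; right.
    have [pi ->] := codom_tuple sk; eexists; exact: K_chosen.
  by eexists; apply: (K_choose_guess _ _ _ _ _ _ (i := Ordinal sk)).
- case=> _ sk; right; have [run|stop] := boolP (ps_running st).
    have [st' step] := ps_progress gamma M guess (P (Ordinal sk)) run.
    by eexists; apply: K_choose_search_step step.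
  by eexists; apply: (K_choose_search_end _ _ _ _ _ _ (i := Ordinal sk)).
- move=> _; right.
  have [stop|] := boolP ((Q == [::]) || (sol_reg b <= L)%E).
    by eexists; exact: K_return stop.
  rewrite negb_or -ltNge => /andP[Q0 lt].
  have [N NQ Nmin] := seq_argmin (bound_partition C (k := k)) Q0.
  by eexists; exact: K_select lt NQ Nmin.
- move=> _; right; have [N0|N0] := eqVneq (unassigned N) set0.
    by eexists; exact: K_leaf.
  have [lt|le] := ltP (bound_partition C N) (sol_reg b).
    case E: (branch_partition ord N) => [m|].
      by eexists; exact: K_branch E.
    (* An unassigned MDP occurs in [ord], so the branching choice cannot be [None]. *)
    have /set0Pn[i iN] := N0.
    have : i \in [seq m <- ord | m \in unassigned N].
      by rewrite mem_filter iN (perm_mem ord_enum) mem_enum.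
    by move: E; rewrite /branch_partition; case: [seq _ <- _ | _].
  by eexists; exact: K_prune.
- case=> _ _ _; rewrite leq_eqVlt => /orP[/eqP|] sk _; right.
    have [res ->] := codom_tuple sk; eexists; exact: K_leaf_end.
  by eexists; exact: K_leaf_search.
- case=> [[_ _ _ sk _] _]; right; have [run|stop] := boolP (ps_running st).
    have [st' step] := ps_progress gamma M guess (N (Ordinal sk)) run.
    by eexists; apply: K_leaf_search_step step.
  by eexists; exact: K_leaf_search_end.
- by move=> _; right; eexists; exact: K_end_iteration.
Qed.

(** * From the invariant to termination and optimality of KAPS *)

Lemma adapt_reg_le_sol_reg (P : parts) (pi : {ffun 'I_k -> policy}) r :
  unassigned P = set0 -> (forall i, ((reg_on (P i) (pi i))%:E <= r)%E) ->
  (adapt_reg pi <= r)%E.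
Proof.
move=> P0 le_r; apply: maxover_le => [|i _].
  by apply: le_trans (le_r (Ordinal k0)); rewrite lee_fin reg_on_ge0.
have : i \notin unassigned P by rewrite P0 inE.
rewrite mem_unassigned => /forallPn[j]; rewrite negbK => iP.
apply: (bigmin_inf j) => //.
apply: le_trans (le_r j); rewrite lee_fin.
exact: (le_maxover _ (reg ^~ (pi j))).
Qed.

End Invariant.
End Kaps.

Theorem theorem2 (R : realType) (S A I : finType) (gamma : R)
    (M : I -> mdp R S A) (k : nat)
    (guess : {set I} -> node S A -> policy S A) (ord : seq I)
    (hgamma : 0 < gamma < 1)
    (hA : (0 < #|A|)%N)
    (hI : (0 < #|I|)%N)
    (hM : forall i, is_mdp (M i))
    (hk : (0 < k)%N)
    (hguess : is_guess_policy gamma M guess)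
    (hord : is_branch_order gamma M guess ord) :
  (* every run terminates *)
  (~ exists run : nat -> config R S A I k,
      kaps_initial (run 0%N) /\
      forall t, kaps_step gamma M guess ord (run t) (run t.+1)) /\
  (* and a run can only stop by returning an optimal solution *)
  (forall c0 c : config R S A I k,
    kaps_initial c0 ->
    clos_refl_trans _ (kaps_step gamma M guess ord) c0 c ->
    (forall c', ~ kaps_step gamma M guess ord c c') ->
    exists (P : parts I k) (pi : {ffun 'I_k -> policy S A}) (r : \bar R),
      c.1 = Return (Solution P [ffun i => Some (pi i)] r) /\
      forall sigma : {ffun 'I_k -> policy S A},
        (adapt_reg gamma M pi <= adapt_reg gamma M sigma)%E).
Proof.
split.
  move=> [run [_ step]].
  have guess_in X N : policies N != set0 -> guess X N \in policies N.
    by move=> /(hguess X N)[].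
  pose f t := phase_measure gamma M guess (run t).1.
  have dec t : (f t.+1 < f t)%N.
    by have [_ /(phase_step_measure guess_in)] := step t.
  have bound t : (f t + t <= f 0)%N.
    by elim: t => [|t IH]; [rewrite addn0|have := dec t; lia].
  by have := bound (f 0%N).+1; rewrite addnS ltnNge leq_addl.
move=> c0 c [P [P0 _] c0P] reach stuck.
have inv : phase_inv gamma M c.1.
  have : phase_inv gamma M c0.1 by rewrite c0P.
  elim: reach => [x y [_ st]|//|x y z _ IHxy _ IHyz /IHxy/IHyz//].
  exact: phase_inv_step st.
have [[b cb]|[p' st]] := phase_progress guess hk c.2 hord.1 inv.
  move: inv; rewrite {}cb => -[[P' [pi [r [-> P'0 le_r]]]] cov].
  exists P', pi, r; split=> // sigma.
  apply: (le_trans (adapt_reg_le_sol_reg hk P'0 le_r)).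
  by case: (cov sigma) => // -[].
(* A phase step that leaves the cache unchanged is a step of the configuration. *)
by case: (stuck (p', c.2)).
Qed.
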